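(* For every integer $k\geq 1$, the class of graphs that contain no member of $\mathcal{D}_k=\{H^2_\ell, (H^2_\ell)^{\mathrm{c}} : \ell\geq k\}$ as an induced subgraph has the strong Erdős–Hajnal property; that is, there exists $\delta>0$ such that every such graph $G$ with at least two vertices has a homogeneous pair $(P,Q)$ with $|P|,|Q|\geq \delta |V(G)|$.
   Context: All graphs are finite and simple; $H^{\mathrm{c}}$ denotes the complement of $H$. For $\ell\geq 1$, the double $\ell$-hook $H^2_\ell$ is the graph on vertices $v_1,\ldots,v_{\ell+8}$ whose edges are $v_iv_{i+1}$ for $1\leq i\leq \ell+5$ (so $v_1,\ldots,v_{\ell+6}$ form a path) together with the pendant edges $v_3v_{\ell+7}$ and $v_{\ell+4}v_{\ell+8}$. For disjoint vertex sets $P,Q$ of a graph $G$, $(P,Q)$ is a homogeneous pair if either every vertex of $P$ is adjacent to every vertex of $Q$ (adjacent pair) or no vertex of $P$ is adjacent to any vertex of $Q$ (anti-adjacent pair). *)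

(* Defs.v *)
From mathcomp Require Import all_boot all_order all_algebra.
From mathcomp Require Import reals.

Set Implicit Arguments.
Unset Strict Implicit.
Unset Printing Implicit Defensive.

Import Order.TTheory GRing.Theory Num.Theory.

Record sgraph := SGraph {
  vertex :> finType;
  adj : rel vertex;
  adj_sym : symmetric adj;
  adj_irrefl : irreflexive adj }.

Definition compl_adj (G : sgraph) : rel G :=
  fun x y => (x != y) && ~~ adj x y.

Lemma compl_adj_sym (G : sgraph) : symmetric (@compl_adj G).
Proof. by move=> x y; rewrite /compl_adj eq_sym adj_sym. Qed.

Lemma compl_adj_irrefl (G : sgraph) : irreflexive (@compl_adj G).
Proof. by move=> x; rewrite /compl_adj eqxx. Qed.

Definition complement (G : sgraph) : sgraph :=
  SGraph (@compl_adj_sym G) (@compl_adj_irrefl G).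

(* G has an induced subgraph isomorphic to H. *)
Definition contains_induced (G H : sgraph) : Prop :=
  exists2 f : H -> G, injective f & forall x y, adj (f x) (f y) = adj x y.

(* The edges v_i v_j of the double l-hook, each listed once, with i < j.
   Here i and j are the subscripts 1, ..., l + 8; the vertex v_i is the element
   of 'I_(l + 8) with value i - 1. *)
Definition double_hook_edge (l i j : nat) : bool :=
  [|| [&& 1 <= i, i <= l + 5 & j == i.+1],
      (i == 3) && (j == l + 7)
    | (i == l + 4) && (j == l + 8)].

Definition double_hook_adj (l : nat) : rel 'I_(l + 8) :=
  fun x y => double_hook_edge l x.+1 y.+1 || double_hook_edge l y.+1 x.+1.

Lemma double_hook_adj_sym l : symmetric (@double_hook_adj l).
Proof. by move=> x y; rewrite /double_hook_adj orbC. Qed.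

Lemma double_hook_adj_irrefl l : irreflexive (@double_hook_adj l).
Proof.
move=> x; rewrite /double_hook_adj /double_hook_edge orbb.
apply/negbTE/negP => /or3P [/and3P [_ _]|/andP [/eqP ->]|/andP [/eqP ->]].
- by rewrite -[X in X == _]addn0 -[X in _ == X]addn1 eqn_add2l.
- by rewrite !addnS.
- by rewrite eqn_add2l.
Qed.

Definition double_hook (l : nat) : sgraph :=
  SGraph (@double_hook_adj_sym l) (@double_hook_adj_irrefl l).

Inductive hook_family (k : nat) : sgraph -> Prop :=
| HookFamily l : k <= l -> hook_family k (double_hook l)
| HookFamilyCompl l : k <= l -> hook_family k (complement (double_hook l)).

Definition induced_free (F : sgraph -> Prop) (G : sgraph) : Prop :=
  forall H, F H -> ~ contains_induced G H.

Definition adjacent_pair (G : sgraph) (P Q : {set G}) : Prop :=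
  {in P & Q, forall x y, adj x y}.

Definition antiadjacent_pair (G : sgraph) (P Q : {set G}) : Prop :=
  {in P & Q, forall x y, ~~ adj x y}.

Definition homogeneous_pair (G : sgraph) (P Q : {set G}) : Prop :=
  [disjoint P & Q] /\ (adjacent_pair P Q \/ antiadjacent_pair P Q).

Local Open Scope ring_scope.

Definition strong_Erdos_Hajnal (R : realType) (C : sgraph -> Prop) : Prop :=
  exists2 delta : R, 0 < delta &
    forall G : sgraph, C G -> (2 <= #|G|)%N ->
    exists P Q : {set G},
      [/\ homogeneous_pair P Q,
          delta * #|G|%:R <= #|P|%:R
        & delta * #|G|%:R <= #|Q|%:R].

(* Main.v *)
(** Forbidding only the double k-hook and its complement is enough.  Both use the
    vertex order in which the hook is a caterpillar grown one vertex at a time,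
    each new vertex being joined to the current tip and either becoming the
    tip or staying a leaf.

    First, the greedy embedding of Erdos and Hajnal finds, in a graph with no
    induced double hook, two large vertex sets between which all degrees are
    small, in the graph or in its complement; a Ramsey-type induction turns
    this into 2^S large sets that are pairwise sparse in the same sense, where
    S + 1 is the number of vertices of the double hook.

    Second, in such a family (after complementing) with no large anti-adjacent
    pair, let each vertex x of each set A_i carry a copy of an initial part of
    the caterpillar with tip x and the other vertices in a set W_i that is
    anti-adjacent to everything else.  Take a minimal X in some A_p whose
    neighbourhood covers a third of some A_j.  As degrees are small, X leaves a
    third of every other set uncovered, so A_j can absorb X and W_p, which
    grows the copies in A_j or those in A_p by one vertex, and A_p is dropped.
    A set carrying copies with i + 1 vertices has weight 2^i; with the right
    choice of p the total weight never decreases, so the last set carries the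
    whole caterpillar. *)

Require Import Defs.
From mathcomp Require Import all_boot all_order all_algebra.
From mathcomp Require Import reals.
From mathcomp Require Import zify.

Set Implicit Arguments.
Unset Strict Implicit.
Unset Printing Implicit Defensive.

Import Order.TTheory GRing.Theory Num.Theory.

(** * Caterpillars grown one vertex at a time *)

Section Caterpillar.
Variable stp : pred nat.

(* The vertices of a caterpillar are numbered in order of creation: vertex i.+1
   is joined to [tip i], and replaces it as tip iff [stp i]. *)
Fixpoint tip (i : nat) : nat :=
  if i is j.+1 then if stp j then j.+1 else tip j else 0.

Lemma tip_le i : tip i <= i.
Proof. by elim: i => //= i IH; case: ifP => // _; exact: leqW. Qed.

Variables (T : finType) (r : rel T).
Hypotheses (r_sym : symmetric r) (r_irr : irreflexive r).

Definition sep x y := (x != y) && ~~ r x y.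

Lemma sep_sym x y : sep x y = sep y x.
Proof. by rewrite /sep eq_sym r_sym. Qed.

(** Each new vertex has exactly one earlier neighbour, the tip at its creation, so the copy is
    induced; values of [f] beyond [i] do not matter. *)
Definition caterpillar_copy (f : nat -> T) i :=
  forall u v, u < v -> v <= i ->
    f u != f v /\ r (f u) (f v) = (u == tip v.-1).

Definition grows (W : {set T}) (x : T) (i : nat) :=
  exists f : nat -> T, [/\ f (tip i) = x,
    forall u, u <= i -> u != tip i -> f u \in W & caterpillar_copy f i].

Lemma caterpillar_copy_extend f i y :
  caterpillar_copy f i -> r (f (tip i)) y ->
  (forall u, u <= i -> u != tip i -> sep (f u) y) ->
  caterpillar_copy (fun u => if u <= i then f u else y) i.+1.
Proof.
move=> fP ry sepy u v ltuv; rewrite leq_eqVlt => /orP[/eqP ev|ltvi]; last first.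
  have levi : v <= i by [].
  by rewrite levi (ltnW (leq_trans ltuv levi)); exact: fP.
rewrite ev ltnn /=; have leui : u <= i by rewrite -ltnS -ev.
rewrite leui; case: (eqVneq u (tip i)) => [->|nu]; last by have /andP[-> /negbTE] := sepy u leui nu.
by rewrite ry; split=> //; apply: contraTneq ry => ->; rewrite r_irr.
Qed.

Lemma grows_leaf (W W' : {set T}) c i y : ~~ stp i -> grows W c i -> r c y ->
  {in W, forall w, sep w y} -> y |: W \subset W' -> grows W' c i.+1.
Proof.
move=> Ni [f [fc fW fP]] rcy sepy sub.
exists (fun u => if u <= i then f u else y); split.
- by rewrite /= (negbTE Ni) tip_le.
- move=> u leui /=; rewrite (negbTE Ni) => nu; apply: (subsetP sub).
  by case: ifP => [le|_]; rewrite !inE ?eqxx // fW ?orbT.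
- apply: caterpillar_copy_extend; rewrite ?fc // => u leui nu.
  by apply: sepy; apply: fW.
Qed.

Lemma grows_step (W W' : {set T}) x i y : stp i -> grows W x i -> r x y ->
  {in W, forall w, sep w y} -> x |: W \subset W' -> grows W' y i.+1.
Proof.
move=> Ni [f [fx fW fP]] rxy sepy sub.
exists (fun u => if u <= i then f u else y); split.
- by rewrite /= Ni ltnn.
- move=> u leui /=; rewrite Ni => nu; apply: (subsetP sub).
  have -> : u <= i by rewrite -ltnS ltn_neqAle nu.
  rewrite !inE; case: (eqVneq u (tip i)) => [->|nr]; first by rewrite fx eqxx.
  by rewrite fW ?orbT // -ltnS ltn_neqAle nu.
- apply: caterpillar_copy_extend; rewrite ?fx // => u leui nu.
  by apply: sepy; apply: fW.
Qed.

Definition deg_in (A : {set T}) x := #|[set y in A | r x y]|.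

Definition nbhd (X : {set T}) := [set y | [exists x in X, r x y]].

Lemma deg_in_sub (A B : {set T}) x : A \subset B -> deg_in A x <= deg_in B x.
Proof.
move=> sub; apply: subset_leq_card; apply/subsetP=> y.
by rewrite !inE => /andP[/(subsetP sub)-> ->].
Qed.

Variable q : nat.
Hypothesis q_gt0 : 0 < q.
Hypothesis no_anticomplete : forall P Q : {set T}, [disjoint P & Q] ->
  q <= #|P| -> q <= #|Q| -> exists x y, [/\ x \in P, y \in Q & r x y].

(** * Merging the sets of a sparse family *)

Section Families.
Variable I : finType.
Implicit Types (D : {set I}) (A W : I -> {set T}).

Definition sparse_family D A :=
  {in D &, forall i j, i != j ->
    [disjoint A i & A j] /\ {in A i, forall x, deg_in (A j) x <= q}}.

(** All of [A p] covers enough of every other [A j], since the uncovered rest is anti-complete to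
    [A p]; hence a minimal [X] exists. Deleting one vertex from it undoes the covering and loses at
    most [q <= s] neighbours, so fewer than [2 * s] vertices of any other [A l] are covered. *)
Lemma cover_step D A p s :
  p \in D -> 1 < #|D| -> q <= s -> {in D, forall i, 3 * s <= #|A i|} ->
  sparse_family D A ->
  exists X : {set T}, X \subset A p /\ exists j, [/\ j \in D, j != p,
    s <= #|A j :&: nbhd X|
    & {in D, forall l, l != p -> l != j -> s <= #|A l :\: nbhd X|}].
Proof.
move=> pD D2 qs bigA sparse.
pose P (X : {set T}) := (X \subset A p) &&
  [exists j in D, (j != p) && (s <= #|A j :&: nbhd X|)].
have PA : P (A p).
  rewrite /P subxx; have [j] : exists j, j \in D :\ p.
    by apply/card_gt0P; rewrite (cardsD1 p) pD in D2; lia.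
  rewrite !inE => /andP[jp jD]; apply/exists_inP; exists j => //; rewrite jp /=.
  rewrite leqNgt; apply/negP=> small.
  have := bigA j jD; rewrite -(cardsID (nbhd (A p)) (A j)) => bigj.
  have bigp := bigA p pD.
  have [|||x [y [xA]]] := @no_anticomplete (A p) (A j :\: nbhd (A p)); try lia.
    apply: disjointWr (subsetDl _ _) _.
    by have [] := sparse p j pD jD; rewrite // eq_sym.
  rewrite !inE => /andP[/existsP Ny _] rxy; apply: Ny.
  by exists x; rewrite xA.
have [X /minsetP[/andP[XA /exists_inP[j jD /andP[jp covj]]] minX]] :
  {X | minset P X} by apply: ex_minset; exists (A p).
exists X; split=> //; exists j; split=> // l lD lp lj.
have [x xX] : exists x, x \in X.
  apply/set0Pn; apply: contraTneq covj => ->.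
  suff -> : A j :&: nbhd set0 = set0 by rewrite cards0 -ltnNge (leq_trans q_gt0).
  apply/setP=> y; rewrite !inE.
  by apply/negbTE/negP=> /andP[_ /exists_inP[z]]; rewrite inE.
have : ~~ P (X :\ x).
  apply/negP=> PX; have := minX _ PX (subsetDl _ _) => E.
  by have := xX; rewrite -E !inE eqxx.
rewrite /P (subset_trans (subsetDl _ _) XA) /= => /exists_inPn /(_ l lD).
rewrite lp /= -ltnNge => ltl.
have degx : deg_in (A l) x <= q.
  have [|_] := sparse p l pD lD; first by rewrite eq_sym.
  by apply; apply: (subsetP XA).
have : #|A l :&: nbhd X| <= #|A l :&: nbhd (X :\ x)| + deg_in (A l) x.
  apply: leq_trans (leq_card_setU _ _); apply: subset_leq_card.
  apply/subsetP=> y; rewrite !inE => /andP[-> /exists_inP[z zX rzy]] /=.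
  case: (eqVneq z x) => [<-|nz]; first by rewrite rzy orbT.
  by apply/orP; left; apply/exists_inP; exists z; rewrite // !inE nz.
have := bigA l lD; rewrite -(cardsID (nbhd X) (A l)); lia.
Qed.


(* [layout_step]: among the sets, at most one needs a new tip rather than a leaf
   to grow; so a copy in A_j can almost always be grown by a leaf. *)
Record layout D A W (lv : I -> nat) s : Prop := Layout {
  layout_card : {in D, forall i, s <= #|A i|};
  layout_sparse : sparse_family D A;
  layout_grows : {in D, forall i, {in A i, forall x, grows (W i) x (lv i)}};
  layout_sep : {in D &, forall i j, i != j ->
    {in W i & A j :|: W j, forall x y, sep x y}};
  layout_step : {in D &, forall i j, stp (lv i) -> stp (lv j) -> i = j} }.

(** The level that grows is always the larger of [lv p] and [lv j], and
    [2 ^ a + 2 ^ b <= 2 ^ (maxn a b).+1]. Leaves fit in [A j] because only [p] may be at a step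
    level; if [p] is not at one, its level is minimal. *)
Lemma layout_merge D A W lv s p :
  layout D A W lv (3 * s) -> q <= s -> 1 < #|D| -> p \in D ->
  (forall l, l \in D -> stp (lv l) -> l = p) ->
  (~~ stp (lv p) -> {in D, forall l, lv p <= lv l}) ->
  exists A' W' lv', layout (D :\ p) A' W' lv' s /\
    \sum_(i in D) 2 ^ lv i <= \sum_(i in D :\ p) 2 ^ lv' i.
Proof.
move=> [cardA spA growA sepW _] qs D2 pD step_p leaf_p.
have [X [XA [j [jD jp covj uncov]]]] := cover_step pD D2 qs cardA spA.
have pj : p != j by rewrite eq_sym.
(* If [climb], the vertices of A_j become tips of the copies carried by A_p;
   otherwise those of X become leaves of the copies carried by A_j. *)
pose climb := stp (lv p) && (lv j <= lv p).
pose A' l := if l == j then A j :&: nbhd X else A l :\: nbhd X.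
pose W' l := if l == j then W j :|: X :|: W p else W l.
pose lv' l := if l == j then (if climb then lv p else lv j).+1 else lv l.
have A'A l : A' l \subset A l.
  by rewrite /A'; case: eqVneq => [->|_]; [apply: subsetIl|apply: subsetDl].
exists A', W', lv'; split; first split.
- move=> l; rewrite !inE => /andP[lp lD]; rewrite /A'.
  by case: eqVneq => // lj; exact: uncov.
- move=> i l; rewrite !inE => /andP[_ iD] /andP[_ lD] il.
  have [dis sp] := spA i l iD lD il; split.
    exact: disjointWl (A'A i) (disjointWr (A'A l) dis).
  by move=> x /(subsetP (A'A i)) /sp; apply: leq_trans; apply: deg_in_sub.
- move=> l; rewrite !inE => /andP[lp lD] y yA'.
  have yA := subsetP (A'A l) y yA'; move: yA'; rewrite /A' /W' /lv'.
  case: eqVneq => [lj|_ _]; last exact: growA.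
  subst l; rewrite !inE => /andP[_ /exists_inP[x xX rxy]].
  have xA := subsetP XA x xX.
  rewrite /climb; case: ifP => [/andP[stp_p _]|].
    apply: (grows_step stp_p (growA p pD x xA) rxy).
      by move=> w wW; apply: (sepW p j) => //; rewrite inE yA.
    by rewrite subUset sub1set !inE xX orbT /= subsetUr.
  move=> _; apply: (grows_leaf (y := x) _ (growA j jD y yA)).
  + by apply: contra jp => /step_p ->.
  + by rewrite r_sym.
  + by move=> w wW; apply: (sepW j p) => //; rewrite inE xA.
  + by rewrite subUset sub1set !inE xX orbT /= -setUA subsetUl.
(* [A' l] has lost all neighbours of [X], so [X] may be added to [W' j]. *)
- have sepX l x y : l != j -> l \in D -> l != p -> x \in X ->
      y \in A' l :|: W l -> sep x y.
    move=> lj lD lp xX; have xA := subsetP XA x xX.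
    rewrite inE => /orP[|yW]; last first.
      by rewrite sep_sym; apply: (sepW l p) => //; rewrite inE xA.
    rewrite /A' (negbTE lj) inE => /andP[Ny yA]; rewrite /sep; apply/andP; split.
      apply: contraTneq xA => ->; have [dis _] := spA l p lD pD lp.
      by rewrite (disjointFr dis yA).
    by apply: contra Ny => rxy; rewrite inE; apply/exists_inP; exists x.
  move=> i l; rewrite !inE => /andP[ip iD] /andP[lp lD] il x y.
  have sub k : k \in D -> {subset A' k :|: W k <= A k :|: W k}.
    by move=> _; apply/subsetP; apply: setSU.
  rewrite /W'; case: (eqVneq i j) => [ij|ij]; last case: (eqVneq l j) => [lj|lj].
  + subst i; rewrite eq_sym in il; rewrite (negbTE il) => + yAW.
    rewrite !inE -orbA => /or3P[xW|xX|xW].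
    * by apply: (sepW j l); rewrite // 1?eq_sym //; exact: sub.
    * exact: sepX yAW.
    * by apply: (sepW p l); rewrite // 1?eq_sym //; exact: sub.
  + subst l => xW; rewrite !inE -!orbA => /or4P[yA|yW|yX|yW].
    * by apply: (sepW i j); rewrite // inE (subsetP (A'A j)).
    * by apply: (sepW i j); rewrite // inE yW orbT.
    * by rewrite sep_sym; apply: (sepX i); rewrite // inE xW orbT.
    * by apply: (sepW i p); rewrite // inE yW orbT.
  + by move=> xW yAW; apply: (sepW i l) => //; exact: sub.
(* With [p] gone, only the new level at [j] can be a step level. *)
- move=> i l; rewrite !inE => /andP[ip iD] /andP[lp lD]; rewrite /lv'.
  case: (eqVneq i j) => [->|ij]; case: (eqVneq l j) => [->|lj] //.
  + by move=> _ /(step_p _ lD) E; rewrite E eqxx in lp.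
  + by move=> /(step_p _ iD) E; rewrite E eqxx in ip.
  + by move=> /(step_p _ iD) E; rewrite E eqxx in ip.
have jD' : j \in D :\ p by rewrite !inE jp.
rewrite (big_setD1 p) //= (big_setD1 j) //= [leqRHS](big_setD1 j) //= addnA.
apply: leq_add; last first.
  by apply: leq_sum => i; rewrite !inE /lv' => /andP[/negbTE-> _].
rewrite /lv' eqxx expnS mul2n -addnn /climb.
have [stp_p|/leaf_p /(_ j jD) lpj] /= := boolP (stp (lv p)).
  by case: (leqP (lv j) (lv p)) => [le|/ltnW le]; rewrite ?leq_add2l ?leq_add2r leq_exp2l.
by rewrite leq_add2r leq_exp2l.
Qed.

(** Each of the [t] merges costs a factor 3 in size. The last set still has at least [q] vertices
    and its level is at least [S]; a copy at one of its vertices is cut down to the first [S.+1]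
    vertices. *)
Lemma layout_copy S D A W lv t :
  layout D A W lv (3 ^ t * q) -> #|D| = t.+1 -> 2 ^ S <= \sum_(i in D) 2 ^ lv i ->
  exists f, caterpillar_copy f S.
Proof.
elim: t D A W lv => [|t IH] D A W lv lay cardD weight.
  have [cardA _ growA _ _] := lay.
  move/eqP/cards1P: cardD => [i Di]; rewrite {}Di in weight cardA growA.
  rewrite big_set1 leq_exp2l // in weight.
  have [x xA] : exists x, x \in A i.
    by apply/card_gt0P; apply: leq_trans (cardA i (set11 i)); rewrite mul1n.
  have [f [_ _ fP]] := growA i (set11 i) x xA.
  by exists f => u v uv vS; apply: fP => //; apply: leq_trans vS weight.
(* By [layout_step] at most one set is at a step level: take it, or else a set of lowest level. *)
have [p [pD step_p leaf_p]] : exists p, [/\ p \in D,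
    forall l, l \in D -> stp (lv l) -> l = p
    & ~~ stp (lv p) -> {in D, forall l, lv p <= lv l}].
  have [/exists_inP[p pD stp_p]|/exists_inPn no] := boolP [exists p in D, stp (lv p)].
    exists p; split=> // [l lD stp_l|]; first exact: (layout_step lay).
    by rewrite stp_p.
  have [i iD] : exists i, i \in D by apply/card_gt0P; rewrite cardD.
  case: (arg_minnP lv iD) => p pD minp; exists p; split=> // l lD.
  by rewrite (negbTE (no l lD)).
rewrite expnS -mulnA in lay.
have [||//|//|A' [W' [lv' [lay' le]]]] := layout_merge lay _ _ pD.
- by rewrite leq_pmull // expn_gt0.
- by rewrite cardD.
apply: IH lay' _ (leq_trans weight le).
by move: cardD; rewrite (cardsD1 p) pD => -[].
Qed.

End Families.

Lemma sparse_family_copy S (A : 'I_(2 ^ S) -> {set T}) :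
  ~~ stp 0 -> {in [set: 'I_(2 ^ S)], forall i, 3 ^ (2 ^ S).-1 * q <= #|A i|} ->
  sparse_family setT A -> exists f, caterpillar_copy f S.
Proof.
move=> stp0 cardA spA.
(* Every vertex starts as a one-vertex copy, so each of the [2 ^ S] sets has weight 1. *)
apply: (@layout_copy _ S setT A (fun=> set0) (fun=> 0) (2 ^ S).-1).
- split=> // [i _ x _|i j _ _ _ x y|i j _ _]; rewrite ?inE ?(negbTE stp0) //.
  by exists (fun=> x); split=> [//|u|u v]; rewrite /= ?leqn0; [move=>/eqP->|lia].
- by rewrite cardsT card_ord prednK // expn_gt0.
- by rewrite sum1_card cardsT card_ord.
Qed.

End Caterpillar.

(** * Sparse pairs by greedy embedding *)

Lemma subset_of_card (T : finType) (A : {set T}) s :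
  s <= #|A| -> exists2 B : {set T}, B \subset A & #|B| = s.
Proof.
move=> sA; exists [set x in take s (enum A)].
  by apply/subsetP=> x; rewrite inE => /mem_take; rewrite mem_enum.
by rewrite cardsE (card_uniqP _) ?take_uniq ?enum_uniq // size_takel // -cardE.
Qed.

Lemma disjoint_subsets_of_card (T : finType) (U : {set T}) m s :
  m * s <= #|U| -> exists B : nat -> {set T},
    [/\ forall i, i < m -> B i \subset U, forall i, i < m -> #|B i| = s
      & forall i j, i < j -> j < m -> [disjoint B i & B j]].
Proof.
elim: m U => [|m IH] U sU; first by exists (fun=> set0).
have [|C CU cC] := @subset_of_card _ U s; first by apply: leq_trans sU; lia.
have [|B [BU cB dB]] := IH (U :\: C); first by rewrite cardsD (setIidPr CU) cC; lia.
exists (fun i => if i == m then C else B i); split.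
- move=> i; case: eqVneq => // ? ?; apply: subset_trans (subsetDl U C); apply: BU; lia.
- move=> i; case: eqVneq => // ? ?; apply: cB; lia.
- move=> i j ij jm; have -> : (i == m) = false by lia.
  case: eqVneq => [_|?]; last by apply: dB; lia.
  by have /subsetDP[] := BU i (leq_trans ij jm).
Qed.

Section Colour.
Variables (T : finType) (e : rel T).
Hypotheses (e_sym : symmetric e).

(** The colour [b] lets a graph and its complement be treated alike. *)
Definition coloured (b : bool) x y := (x != y) && (e x y == b).

Lemma coloured_sym b : symmetric (coloured b).
Proof. by move=> x y; rewrite /coloured eq_sym e_sym. Qed.

Lemma coloured_irr b : irreflexive (coloured b).
Proof. by move=> x; rewrite /coloured eqxx. Qed.

(** At most [c * q * q] edges join [P] and [Q], so at most [c * q] vertices of [Q] have degree above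
    [q]. *)
Lemma bipartite_degree (r : rel T) (P Q : {set T}) c q : symmetric r ->
  #|P| = c * q -> 2 * (c * q) <= #|Q| ->
  {in P, forall x, deg_in r Q x <= q} ->
  exists2 Q' : {set T}, Q' \subset Q &
    #|Q'| = c * q /\ {in Q', forall y, deg_in r P y <= q}.
Proof.
move=> r_sym cP cQ degP; pose G := [set y in Q | deg_in r P y <= q].
have dbl : \sum_(y in Q) deg_in r P y = \sum_(x in P) deg_in r Q x.
  transitivity (\sum_(y in Q) \sum_(x in P) (r x y : nat)).
    apply: eq_bigr => y _; rewrite /deg_in -sum1dep_card big_mkcondr /=.
    by apply: eq_bigr => x _; rewrite r_sym; case: (r x y).
  rewrite exchange_big /=; apply: eq_bigr => x _.
  rewrite /deg_in -sum1dep_card [RHS]big_mkcondr /=.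
  by apply: eq_bigr => y _; case: (r x y).
have bad : #|Q :\: G| * q.+1 <= (c * q) * q.
  rewrite -cP; apply: (@leq_trans (\sum_(y in Q) deg_in r P y)); last first.
    by rewrite dbl -sum_nat_const; apply: leq_sum.
  rewrite -sum_nat_const [leqRHS](big_setID G) /=.
  apply: leq_trans (leq_addl _ _); apply: leq_sum => y.
  by rewrite !inE => /andP[+ yQ]; rewrite yQ /= -ltnNge.
have GQ : G \subset Q by apply/subsetP=> y; rewrite inE => /andP[].
have [|Q' Q'G cQ'] := @subset_of_card _ G (c * q).
  have := cardsID G Q; rewrite (setIidPr GQ); nia.
exists Q'; first exact: subset_trans GQ.
by split=> // y /(subsetP Q'G); rewrite inE => /andP[].
Qed.

Definition biregular_pair (b : bool) (P Q : {set T}) q :=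
  [/\ [disjoint P & Q], {in P, forall x, deg_in (coloured b) Q x <= q}
    & {in Q, forall y, deg_in (coloured b) P y <= q}].

(** The factor [m] pays for a pigeonhole over the earlier sets, [2 * c] for [bipartite_degree]. *)
Fixpoint embedding_size c m :=
  if m is m'.+1 then 2 * c * m * embedding_size c m' else 1.

Lemma embedding_size_gt0 c m : 0 < c -> 0 < embedding_size c m.
Proof. by move=> c0; elim: m => //= m IH; rewrite !muln_gt0 c0. Qed.

(** Vertices are chosen from the last set down. One with at least [d] neighbours of the prescribed
    colour in every earlier set shrinks those sets to these neighbours. If there is none, many
    vertices of the last set fail towards the same [B j], which gives a pair sparse in colour
    [h j m] with [q' = d]. *)
Lemma greedy_embedding (x0 : T) (h : rel nat) c m q (B : nat -> {set T}) :
  0 < c -> 0 < q ->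
  (forall i, i < m -> embedding_size c m * q <= #|B i|) ->
  (forall i j, i < j -> j < m -> [disjoint B i & B j]) ->
  (exists2 f : nat -> T, forall i, i < m -> f i \in B i &
     forall i j, i < j -> j < m -> e (f i) (f j) = h i j) \/
  exists b q' (P Q : {set T}), [/\ q <= q', #|P| = c * q', #|Q| = c * q',
    biregular_pair b P Q q'
    & exists i j, [/\ i < m, j < m, P \subset B i & Q \subset B j]].
Proof.
move=> c0 q0; elim: m B => [|m IH] B cB dB; first by left; exists (fun=> x0).
set d := embedding_size c m * q.
have d0 : 0 < d by rewrite muln_gt0 embedding_size_gt0.
have qd : q <= d by rewrite leq_pmull // embedding_size_gt0.
have cB' i : i < m.+1 -> 2 * c * m.+1 * d <= #|B i|.
  by move=> im; rewrite /d mulnA; exact: cB.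
pose r j := coloured (h j m).
have [/exists_inP[x xB /forallP bigx]|/exists_inPn small] :=
    boolP [exists x in B m, [forall j : 'I_m, d <= deg_in (r j) (B j) x]].
  have [|||] := IH (fun j => [set y in B j | r j x y]).
  - by move=> j jm; have := bigx (Ordinal jm).
  - move=> i j ij jm; apply: disjointWl (disjointWr _ (dB i j ij _)); last lia.
    + by apply/subsetP=> y; rewrite inE => /andP[].
    + by apply/subsetP=> y; rewrite inE => /andP[].
  - move=> [f fB fh]; left; exists (fun i => if i == m then x else f i).
    + move=> i; case: eqVneq => [->//|? ?]; have := fB i; rewrite inE; lia.
    + move=> i j ij jm; have -> : (i == m) = false by lia.
      case: eqVneq => [->|?]; last by apply: fh; lia.
      have := fB i; rewrite inE => /(_ _)/andP[|_ /andP[_ /eqP<-]]; first lia.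
      by rewrite e_sym.
  - move=> [b [q' [P [Q [qq' cP cQ bi [i [j [im jm PB QB]]]]]]]]; right.
    exists b, q', P, Q; split=> //; exists i, j; split; try exact: leqW.
    + by apply: subset_trans PB _; apply/subsetP=> y; rewrite inE => /andP[].
    + by apply: subset_trans QB _; apply/subsetP=> y; rewrite inE => /andP[].
right; pose bad (j : 'I_m) := [set x in B m | deg_in (r j) (B j) x <= d].
have [j bigj] : exists j, c * d <= #|bad j|.
  apply/existsP; apply: contraT => /existsPn smallj.
  have : #|B m| <= m * (c * d).
    apply: leq_trans (_ : #|\bigcup_j bad j| <= _).
      apply: subset_leq_card; apply/subsetP=> x xB.
      have /forallPn[j] := small x xB; rewrite -ltnNge => /ltnW ltj.
      by apply/bigcupP; exists j; rewrite // inE xB.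
    rewrite -[m in m * _]card_ord -sum_nat_const.
    elim/big_ind2: _ => [|A1 n1 A2 n2 le1 le2|j _]; first by rewrite cards0.
    + by apply: leq_trans (leq_card_setU _ _) (leq_add le1 le2).
    + by have := smallj j; rewrite -ltnNge => /ltnW.
  have := cB' m (ltnSn m); nia.
have [P Pbad cP] := subset_of_card bigj.
have jm := ltn_ord j.
have PB : P \subset B m by apply: subset_trans Pbad _; apply/subsetP=> y; rewrite inE => /andP[].
have degP : {in P, forall x, deg_in (r j) (B j) x <= d}.
  by move=> x /(subsetP Pbad); rewrite inE => /andP[].
have [|Q QB [cQ degQ]] := bipartite_degree (@coloured_sym _) cP _ degP.
  by apply: leq_trans (cB' j (ltnW _)) => //; nia.
exists (h j m), d, P, Q; split=> //; last by exists m, j; split=> //; lia.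
split=> //.
- by rewrite disjoint_sym; apply: disjointWl QB (disjointWr PB (dB j m jm _)).
- by move=> x /degP; apply: leq_trans; apply: deg_in_sub.
Qed.

Definition biregular_family (b : bool) L q m (U : {set T}) (B : nat -> {set T}) :=
  (forall i, i < m -> B i \subset U /\ L * q <= #|B i|) /\
  (forall i j, i < j -> j < m -> biregular_pair b (B i) (B j) q).

End Colour.

(** * Ramsey induction for sparse families *)

Lemma biregular_pair_sub (T : finType) (e : rel T) b (P P' Q Q' : {set T}) q q' :
  biregular_pair e b P Q q -> P' \subset P -> Q' \subset Q -> q <= q' ->
  biregular_pair e b P' Q' q'.
Proof.
move=> [dis dP dQ] PP QQ qq; split.
- exact: disjointWl PP (disjointWr QQ dis).
- move=> x /(subsetP PP)/dP le; apply: leq_trans (leq_trans le qq); exact: deg_in_sub.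
- move=> x /(subsetP QQ)/dQ le; apply: leq_trans (leq_trans le qq); exact: deg_in_sub.
Qed.

Lemma biregular_pair_exists n c : 0 < c -> exists2 C, 0 < C &
  forall (T : finType) (e : rel T) (h : rel nat) (U : {set T}) q, symmetric e ->
  0 < q -> C * q <= #|U| ->
  (forall f : nat -> T, (forall i j, i < j -> j < n -> f i != f j) ->
     ~ (forall i j, i < j -> j < n -> e (f i) (f j) = h i j)) ->
  exists b q' (P Q : {set T}), [/\ q <= q', #|P| = c * q', #|Q| = c * q',
    biregular_pair e b P Q q' & P \subset U /\ Q \subset U].
Proof.
(* [n.+1] rather than [n] makes [U] nonempty also for [n = 0]. *)
move=> c0; exists (n.+1 * embedding_size c n); first by rewrite muln_gt0 embedding_size_gt0.
move=> T e h U q e_sym q0 cU free.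
have s0 := embedding_size_gt0 n c0.
have [x0 _] : exists x, x \in U by apply/card_gt0P; apply: leq_trans cU; rewrite !muln_gt0 s0.
have [|B [BU cB dB]] := @disjoint_subsets_of_card _ U n (embedding_size c n * q).
  by apply: leq_trans cU; rewrite -mulnA leq_mul2r leqnSn orbT.
have [||] := greedy_embedding e_sym x0 h c0 q0 _ dB; first by move=> i /cB->.
  move=> [f fB fh]; case: (free f) => // i j ij jn; have := dB i j ij jn.
  apply: contraTneq => fij; apply/pred0Pn; exists (f i) => /=.
  by rewrite fB ?(ltn_trans ij jn) //= fij fB.
move=> [b [q' [P [Q [qq' cP cQ bi [i [j [im jm PB QB]]]]]]]].
exists b, q', P, Q; split=> //; split.
- exact: subset_trans PB (BU i im).
- exact: subset_trans QB (BU j jm).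
Qed.

(** Induction on [m true + m false]: given a sparse pair [(P, Q)] of colour [b], find inside [P] a
    family with one set fewer required in colour [b]; if it has colour [b], add [Q] as last set. The
    degree bound may have grown, but [L * q' <= #|U|], applied to [P], shows that [Q], as large as
    [P], is still big enough. *)
Lemma ramsey_biregular n L (m : bool -> nat) : 0 < L -> exists2 C, 0 < C &
  forall (T : finType) (e : rel T) (h : rel nat) (U : {set T}) q, symmetric e ->
  0 < q -> C * q <= #|U| ->
  (forall f : nat -> T, (forall i j, i < j -> j < n -> f i != f j) ->
     ~ (forall i j, i < j -> j < n -> e (f i) (f j) = h i j)) ->
  exists b q' B, [/\ q <= q', L * q' <= #|U| & biregular_family e b L q' (m b) U B].
Proof.
move=> L0; have [k mk] := ubnPleq (m true + m false).
elim: k m mk => [|k IH] m mk.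
  exists L => // T e h U q _ q0 LU _; exists true, q, (fun=> set0); split=> //.
  by split=> [i|i j _]; have -> : m true = 0 by lia.
have [/existsP[b /eqP mb]|/existsPn mpos] := boolP [exists b, m b == 0].
  exists L => // T e h U q _ q0 LU _; exists b, q, (fun=> set0); split=> //.
  by split=> [i|i j _]; rewrite mb.
pose less b b' := if b' == b then (m b').-1 else m b'.
have lessIH b : less b true + less b false <= k.
  have := mpos true; have := mpos false; rewrite /less; case: b => /=; lia.
have [C0 C00 PC0] := IH _ (lessIH false); have [C1 C10 PC1] := IH _ (lessIH true).
(* The colour of the pair is not known in advance, so [P] must suit both recursive calls. *)
have [|C C_gt0 PC] := @biregular_pair_exists n (C0 + C1); first by rewrite addn_gt0 C00.
exists C => // T e h U q e_sym q0 CU free.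
have [b [q1 [P [Q [qq1 cP cQ bi [PU QU]]]]]] := PC T e h U q e_sym q0 CU free.
have q10 := leq_trans q0 qq1.
have [b' [q2 [B [q12 LP [BP famB]]]]] :
    exists b' q2 B, [/\ q1 <= q2, L * q2 <= #|P|
      & biregular_family e b' L q2 (less b b') P B].
  by case: b {bi}; [apply: (PC1 T e h P q1) | apply: (PC0 T e h P q1)];
    rewrite ?cP ?leq_mul2r ?leq_addl ?leq_addr ?orbT.
have LU : L * q2 <= #|U| by apply: leq_trans LP (subset_leq_card PU).
have BU i : i < less b b' -> B i \subset U /\ L * q2 <= #|B i|.
  by move=> /BP[BPi ?]; split=> //; apply: subset_trans PU.
move: BU famB; rewrite /less in BP *; case: eqVneq BP => [->|_] BP BU famB.
  exists b, q2, (fun i => if i == (m b).-1 then Q else B i); split.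
  - exact: leq_trans qq1 q12.
  - by [].
  split=> [i im|i j ij jm].
  - case: eqVneq => [_|ne]; first by split; rewrite // cQ -cP.
    by apply: BU; lia.
  - have -> : (i == (m b).-1) = false by lia.
    case: eqVneq => [_|ne]; last by apply: famB; lia.
    apply: biregular_pair_sub bi _ (subxx _) q12.
    by have [|] := BP i; first lia.
exists b', q2, B; split=> //; exact: leq_trans qq1 q12.
Qed.

(** * The double hook as a caterpillar *)

Section Hook.
Variable l : nat.
Hypothesis l_gt0 : 0 < l.

(* The order of creation is v_2, v_1, v_3, v_(l+7), v_4, ..., v_(l+4), v_(l+8),
   v_(l+5), v_(l+6).  Starting from v_2 rather than v_1 makes 0 a leaf level, as
   needed for [layout_step] to hold initially. *)
Definition hook_step : pred nat := [pred i | i \notin [:: 0; 2; l + 4]].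

Lemma hook_tipE i :
  tip hook_step i = i - ((i == 1) || (i == 3) || (i == l + 5)).
Proof. by elim: i => //= i ->; rewrite /hook_step /= !inE; case: ifP; lia. Qed.

Definition hook_order (x : nat) : nat :=
  if x == 0 then 1 else if x == 1 then 0 else if x == 2 then 2 else
  if x <= l + 3 then x.+1 else if x <= l + 5 then x + 2 else
  if x == l + 6 then 3 else l + 5.

Lemma hook_order_inj x y : x < l + 8 -> y < l + 8 ->
  hook_order x = hook_order y -> x = y.
Proof. by rewrite /hook_order => xl yl; do !case: ifP => ?; lia. Qed.

Lemma hook_order_le x : x < l + 8 -> hook_order x <= l + 7.
Proof. by rewrite /hook_order => xl; do !case: ifP => ?; lia. Qed.

Lemma hook_order_edge x y : x < l + 8 -> y < l + 8 ->
  hook_order x < hook_order y ->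
  (hook_order x == tip hook_step (hook_order y).-1) =
  double_hook_edge l x.+1 y.+1 || double_hook_edge l y.+1 x.+1.
Proof.
rewrite hook_tipE /hook_order /double_hook_edge => xl yl.
(do !case: ifP => ?) => ?; do !(case: eqVneq => ? //=; try (exfalso; lia));
  by do !(case: leqP => ? //=; try lia).
Qed.

Lemma hook_copy (G : sgraph) b (f : nat -> G) :
  caterpillar_copy hook_step (coloured (@adj G) b) f (l + 7) ->
  contains_induced G (if b then double_hook l else complement (double_hook l)).
Proof.
move=> fP; pose g (x : 'I_(l + 8)) := f (hook_order x).
have gP (x y : 'I_(l + 8)) : hook_order x < hook_order y ->
    g x != g y /\ adj (g x) (g y) = (b == double_hook_adj x y).
  move=> xy; have [ne] := fP _ _ xy (hook_order_le (ltn_ord y)).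
  rewrite hook_order_edge // -/(double_hook_adj x y) /coloured ne /= => <-.
  by split=> //; rewrite /g; case: (b); case: (adj _ _).
have gP' x y : x != y ->
    g x != g y /\ adj (g x) (g y) = (b == double_hook_adj x y).
  move=> xy; have : hook_order x != hook_order y.
    by apply: contra xy => /eqP/hook_order_inj E; apply/eqP/val_inj/E.
  rewrite neq_ltn => /orP[/gP//|/gP[]]; rewrite eq_sym adj_sym => ne ->.
  by rewrite double_hook_adj_sym.
have g_inj : injective g.
  by move=> x y gxy; apply/eqP; apply: contraT => /gP'[]; rewrite gxy eqxx.
have g_irr x : adj (g x) (g x) = false by exact: adj_irrefl.
case: b {fP gP} gP' => gP; exists g => // x y;
  have [->|ne] := eqVneq x y; rewrite ?g_irr ?adj_irrefl //;
  have [_ ->] := gP x y ne.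
- by rewrite -[RHS]/(double_hook_adj x y).
- by rewrite -[RHS]/((x != y :> 'I_(l + 8)) && ~~ double_hook_adj x y) ne.
Qed.

End Hook.

(** * Homogeneous pairs *)

Lemma homogeneous_pair_exists (l : nat) : 0 < l -> exists2 C, 0 < C &
  forall (G : sgraph) q, 0 < q -> C * q <= #|G| ->
  (forall b, ~ contains_induced G (if b then double_hook l else complement (double_hook l))) ->
  exists P Q : {set G}, [/\ homogeneous_pair P Q, q <= #|P| & q <= #|Q|].
Proof.
move=> l0; pose S := l + 7; pose stp := hook_step l.
have [|C C0 PC] := @ramsey_biregular S.+1 (3 ^ (2 ^ S).-1) (fun=> 2 ^ S).
  by rewrite expn_gt0.
exists C => // G q q0 CG free.
pose homog := [exists P : {set G}, [exists Q : {set G}, [&& [disjoint P & Q],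
  q <= #|P|, q <= #|Q| & [exists b, [forall x in P, [forall y in Q, adj x y == b]]]]]].
have [/existsP[P /existsP[Q /and4P[dis cP cQ /existsP[b /forall_inP hom]]]]|nohom] :=
    boolP homog.
  have {}hom : {in P & Q, forall x y, adj x y = b}.
    by move=> x y xP yQ; apply/eqP; apply: (forall_inP (hom x xP)).
  exists P, Q; split=> //; split=> //.
  by case: b hom => hom; [left|right] => x y xP yQ; rewrite hom.
(* The forbidden pattern is the caterpillar on [S.+1 = l + 8] vertices, listed in order of
   creation. *)
have [||b [q' [B [qq' _ [cB biB]]]]] :=
  PC G (@adj G) (fun i j => i == tip stp j.-1) setT q (@adj_sym G) q0.
- by rewrite cardsT.
- move=> f f_inj fP; apply: (free true); apply: (@hook_copy l l0 G true f).
  move=> u v uv vS; split; first exact: f_inj.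
  by rewrite /coloured f_inj //= fP // eqb_id.
have q'0 := leq_trans q0 qq'.
have [||i _|i j _ _ ij|f fP] := @sparse_family_copy stp _ _
    (@coloured_sym _ _ (@adj_sym G) b) (@coloured_irr _ _ b) q' q'0 _ S (fun i => B i).
(* Disjoint sets with no edge of colour [b] between them have constant adjacency [~~ b]; as
   [q <= q'], this contradicts [nohom]. *)
- move=> P Q dis qP qQ.
  have [/exists_inP[x xP /exists_inP[y yQ rxy]]|/exists_inPn none] :=
    boolP [exists x in P, [exists y in Q, coloured (@adj G) b x y]].
    by exists x, y.
  case/negP: nohom; apply/existsP; exists P; apply/existsP; exists Q.
  rewrite dis !(leq_trans qq') //=; apply/existsP; exists (~~ b).
  apply/forall_inP=> x xP; apply/forall_inP=> y yQ.
  have /exists_inPn/(_ y yQ) := none x xP; rewrite /coloured.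
  have -> : x != y by apply: contraTneq xP => ->; rewrite (disjointFl dis yQ).
  by case: (b); case: (adj x y).
- by [].
- by have [] := cB i (ltn_ord i).
- have [/biB[|dis dP _]|/biB[|dis _ dP]|E] := ltngtP (i : nat) j.
  + exact: ltn_ord.
  + by split.
  + exact: ltn_ord.
  + by rewrite disjoint_sym; split.
  + by case/eqP: ij; apply: val_inj.
- by case: (free b); apply: (hook_copy l0 fP).
Qed.

Theorem theorem1p4 (R : realType) (k : nat) (hk : 1 <= k) :
  strong_Erdos_Hajnal R (induced_free (hook_family k)).
Proof.
have [C C0 PC] := homogeneous_pair_exists hk.
have C2 : (0 < (2 * C)%:R :> R)%R by rewrite ltr0n muln_gt0.
(* Single vertices suffice if [#|G| < C]; otherwise the factor 2 absorbs the rounding in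
   [#|G| %/ C]. *)
exists ((2 * C)%:R^-1)%R => [|G free G2]; first by rewrite invr_gt0.
have bound s : #|G| <= 2 * C * s -> ((2 * C)%:R^-1 * #|G|%:R <= s%:R :> R)%R.
  by move=> le; rewrite ler_pdivrMl // -natrM ler_nat.
have [small|large] := ltnP #|G| C.
  have [x [y [_ _ xy]]] : exists x y : G, [/\ x \in G, y \in G & x != y].
    by apply/card_gt1P.
  exists [set x], [set y]; rewrite !cards1; split; try by apply: bound; lia.
  split; first by rewrite disjoints1 inE.
  by have [a|a] := boolP (adj x y); [left|right] => u v /set1P-> /set1P->.
have [||b|P [Q [hom cP cQ]]] := PC G (#|G| %/ C).
- by rewrite divn_gt0.
- by rewrite mulnC leq_divM.
- by apply: free; case: b; [apply: HookFamily|apply: HookFamilyCompl].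
have le : #|G| <= 2 * C * (#|G| %/ C).
  have := ltn_ceil #|G| C0; have : 0 < #|G| %/ C by rewrite divn_gt0.
  by nia.
by exists P, Q; split=> //; apply: bound; apply: leq_trans le _; rewrite leq_mul2l ?cP ?cQ orbT.
Qed.
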